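(* There is an absolute constant $C>0$ such that for all sufficiently large $n$, every edge-ordering of the complete graph $K_n$ contains a monotone path of length at least $$\frac{n}{2^{C\sqrt{\log n\,\log\log n}}}.$$ In other words, $f(K_n)\ge n/2^{O(\sqrt{\log n\log\log n})}=n^{1-o(1)}$.
   Context: An edge-ordering of a graph $G$ is a total order $\le_G$ on $E(G)$. A path is monotone if its consecutive edges form a monotone sequence with respect to $\le_G$. The altitude $f(G)$ is the maximum $k$ such that every edge-ordering of $G$ has a monotone path of length $k$ (length = number of edges). All logarithms are base 2. *)

(* Defs.v *)
From mathcomp Require Import all_boot.
From Stdlib Require Import Reals.
Set Implicit Arguments. Unset Strict Implicit. Unset Printing Implicit Defensive.

Definition is_edge (n : nat) (e : {set 'I_n}) : bool := #|e| == 2.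

(* An edge-ordering of K_n: a relation [le] which is a total order on the
   edge set of K_n (its values on non-edges are irrelevant). *)
Definition edge_ordering (n : nat) (le : rel {set 'I_n}) : Prop :=
  [/\ (forall e, is_edge e -> le e e),
      (forall e f, is_edge e -> is_edge f -> le e f -> le f e -> e = f),
      (forall e f g, is_edge e -> is_edge f -> is_edge g ->
          le e f -> le f g -> le e g)
    & (forall e f, is_edge e -> is_edge f -> le e f || le f e)].

Definition path_edges (n : nat) (p : seq 'I_n) : seq {set 'I_n} :=
  map (fun uv => [set uv.1; uv.2]) (zip p (behead p)).

(* A path in K_n (distinct vertices; every pair is adjacent in K_n) whose
   consecutive edges form a monotone (nondecreasing or nonincreasing)
   sequence w.r.t. le. Its length is (size p).-1 edges. *)
Definition monotone_path (n : nat) (le : rel {set 'I_n}) (p : seq 'I_n) : Prop :=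
  uniq p /\
  (sorted le (path_edges p) \/ sorted (fun e f => le f e) (path_edges p)).

Definition log2 (x : R) : R := (ln x / ln 2)%R.

(* Main.v *)
Require Import Defs.
From mathcomp Require Import all_boot zify.
From Stdlib Require Import Reals Lra.
Import ssrnat.
Set Implicit Arguments. Unset Strict Implicit. Unset Printing Implicit Defensive.

(* Order the edges by weights.  Write [forces D l] when every bipartite graph
   with more than D edges per vertex has a monotone path with l edges.  The
   heart of the proof bootstraps this property.

   Insert the edges by decreasing weight, each on top of the shorter of the two
   columns of its endpoints.  An edge found at height h in a column then meets,
   below height h in the columns of both endpoints, heavier edges only; so a
   path that descends through the columns is monotone.  Cut the columns into
   windows of d cells.  From the tip of the current path p, let R_j be the set
   of vertices reached through j successive windows while avoiding p.  If
   |R_(j+1)| >= 2|R_j| for all j < q, then 2^q exceeds the number of vertices.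
   Otherwise the arcs from R_j to R_(j+1) form a graph so dense that
   [forces D l] yields a monotone path Q inside it.  Q may meet the short path
   that leads from the tip of p to Q, but only in q vertices, so one of the gaps
   of Q between these meetings prolongs p by about l/q edges, at the cost of q
   windows.  Iterating, [forces D (q(g+1))] gives
   [forces (t q (L + 3D + 1)) L] whenever L <= t g.

   With q ~ log n and Y = 10 q^2 this gives [forces a_(k+1) a_k] for all k, where
   a_k = Y^((k+1)(k+2)/2).  For the largest k with 8 a_(k+1) <= n one has
   n <= 8 a_k Y^(2k+5), and k = O(sqrt(log n / log log n)). *)

(** * Descending paths in weighted graphs *)

Section WeightedGraph.

Variables (T : finType) (w : T -> T -> nat).
Hypothesis wC : forall x y, w x y = w y x.
Hypothesis w_inj : forall x y x' y', x != y -> x' != y' ->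
  w x y = w x' y' -> [set x; y] = [set x'; y'].

(* Paths are listed from their tip backwards: weights decrease along the list. *)
Fixpoint descending (b : nat) (s : seq T) : bool :=
  if s is x :: s' then
    if s' is y :: _ then (w x y < b) && descending (w x y) s' else true
  else true.

Lemma descending_le b c s : b <= c -> descending b s -> descending c s.
Proof.
by case: s => [|x [|y s]] //= bc /andP[xb ->]; rewrite (leq_trans xb bc).
Qed.

Lemma descending_suffix b s1 s2 : descending b (s1 ++ s2) -> descending b s2.
Proof.
elim: s1 b => // x s1 IH b /= H; apply: IH.
by case: (s1 ++ s2) H => // y s /andP[/ltnW xb]; apply: descending_le.
Qed.

Lemma descending_prefix b s1 s2 : descending b (s1 ++ s2) -> descending b s1.
Proof.
elim: s1 b => // x s1 IH b; case: s1 IH => // y s1 IH /andP[xb ds].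
by apply/andP; split=> //; apply: IH.
Qed.

Lemma descending_head b x y s :
  descending b (x :: y :: s) -> descending (w x y).+1 (x :: y :: s).
Proof. by case/andP=> _ /= ->; rewrite ltnSn. Qed.

(** The edge into [v] weighs at least [b] and the new tail stays below [b], so weights still drop at
    [v]. This is how [detour] leaves [Q] for the older path. *)
Lemma descending_splice B b s v s1 s2 :
  s != [::] -> descending B (s ++ v :: s1) -> b <= w (last v s) v ->
  descending b (v :: s2) -> descending B (s ++ v :: s2).
Proof.
case: s => // x s _; elim: s x B => [|y s IH] x B /=.
  by move=> /andP[-> _] bw ds; apply: (@descending_le _ _ (v :: s2) bw ds).
by move=> /andP[-> H] bw ds; apply: IH H _ ds.
Qed.

Lemma descending_low B b s x1 x0 :
  descending B (s ++ [:: x1; x0]) -> b <= w x1 x0 ->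
  sorted (fun x y => b <= w x y) (s ++ [:: x1; x0]).
Proof.
move=> + bw; elim: s B => [|x s IH] B /=; first by rewrite bw.
have [y [z [r E]]] : exists y z r, s ++ [:: x1; x0] = y :: z :: r.
  by case: s {IH} => [|y [|z s]] /=; do 3!eexists.
rewrite E in IH *; move=> /andP[_ dr]; have /= := IH _ dr.
by case/andP: dr => /ltnW yz _ /andP[byz ->]; rewrite byz (leq_trans byz yz).
Qed.

Lemma sorted_consecutive (e : rel T) s1 a b s2 : sorted e (s1 ++ a :: b :: s2) -> e a b.
Proof. by case: s1 => [|c s1] /=; [case/andP | rewrite cat_path /= => /and4P[]]. Qed.

Definition adj (F : {set T * T}) x y := ((x, y) \in F) || ((y, x) \in F).

(** [F] lists each edge once, from its end in [X]. Density is measured on any [U] covering the ends,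
    so that [round] can apply the property to a small dense subgraph. *)
Definition forces (D l : nat) : Prop :=
  forall (X U : {set T}) (F : {set T * T}),
    (forall x y, (x, y) \in F -> [/\ x \in X, y \notin X, x \in U & y \in U]) ->
    D * #|U| < #|F| ->
  exists p, [/\ l < size p, uniq p, sorted (adj F) p & exists B, descending B p].

Lemma forces_mono D D' l l' : D <= D' -> l' <= l -> forces D l -> forces D' l'.
Proof.
move=> DD ll fDl X U F FXU DF.
have [|p [lp up sp dp]] := fDl X U F FXU.
  by apply: leq_ltn_trans DF; rewrite leq_mul2r DD orbT.
by exists p; split=> //; apply: leq_ltn_trans lp.
Qed.

(** * Columns of edges *)

(* A path arriving at [x] by an edge lighter than [b] can be prolonged by any of
   the lowest [H] cells of column [x]. *)
Definition ready (col : T -> seq T) x b H :=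
  (H <= size (col x)) && all (fun u => b <= w x u) (take H (col x)).

Definition height_table (F : {set T * T}) (col : T -> seq T) : Prop :=
  [/\ forall x, uniq (col x),
      forall x y, y \in col x -> adj F x y,
      \sum_x size (col x) = #|F|
    & forall x h u, h < size (col x) -> nth x (col x) h = u ->
        ready col x (w x u).+1 h && ready col u (w x u).+1 h].

Lemma ready_le col x b c H H' : c <= b -> H' <= H -> ready col x b H -> ready col x c H'.
Proof.
move=> cb HH /andP[sH aH]; rewrite /ready (leq_trans HH sH) /=.
apply/(all_nthP x) => i; rewrite size_take_min leq_min => /andP[iH' ic].
have iH := leq_trans iH' HH.
have := all_nthP x aH i; rewrite size_take_min leq_min iH ic !nth_take // => /(_ isT).
exact: leq_trans.
Qed.

Lemma ready_rcons col x y u b H :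
  ready col u b H -> ready (fun z => if z == x then rcons (col z) y else col z) u b H.
Proof.
rewrite /ready; case: eqP => // _ /andP[sH aH].
by rewrite size_rcons leqW //= -cats1 takel_cat.
Qed.

(** [w_inj] recovers only the unordered pair; membership in [X] tells its two ends apart. *)
Lemma bip_adj_inj (X : {set T}) (F : {set T * T}) e e' :
  (forall x y, (x, y) \in F -> x \in X /\ y \notin X) ->
  e \in F -> e' \in F -> w e.1 e.2 = w e'.1 e'.2 -> e = e'.
Proof.
case: e e' => x y [x' y'] FX /FX[xX yX] /FX[xX' yX'] /= E.
have ne a b : a \in X -> b \notin X -> a != b by move=> aX; apply: contraNneq => <-.
have ES := w_inj (ne _ _ xX yX) (ne _ _ xX' yX') E.
have : y \in [set x'; y'] by rewrite -ES set22.
have : x \in [set x'; y'] by rewrite -ES set21.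
rewrite !inE => /orP[/eqP xE|/eqP xE]; last by rewrite -xE xX in yX'.
by case/orP=> /eqP yE; [rewrite yE xX' in yX | rewrite xE yE].
Qed.

(** The induction removes the lightest edge [e] and puts it back last. All cells then present are
    heavier than [e], and choosing the shorter column ensures that the column of the other end also
    reaches that height. *)
Lemma height_table_exists (X : {set T}) (F : {set T * T}) :
  (forall x y, (x, y) \in F -> x \in X /\ y \notin X) ->
  exists col, height_table F col.
Proof.
have [m] := ubnP #|F|; elim: m F => // m IH F; rewrite ltnS => Fm FX.
have [->|[e0 e0F]] := set_0Vmem F.
  by exists (fun=> [::]); split=> //; rewrite big1 // cards0.
pose e := [arg min_(e < e0 in F) w e.1 e.2].
have [eF emin] : e \in F /\ forall f, f \in F -> w e.1 e.2 <= w f.1 f.2.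
  by rewrite /e; case: arg_minnP.
have FX' x y : (x, y) \in F :\ e -> x \in X /\ y \notin X.
  by rewrite inE => /andP[_ /FX].
have [|col [ucol acol scol tcol]] := IH (F :\ e) _ FX'.
  by rewrite (cardsD1 e) eF in Fm.
have heavier x y : adj (F :\ e) x y -> w e.1 e.2 < w x y.
  have lt f : f \in F :\ e -> w e.1 e.2 < w f.1 f.2.
    rewrite !inE => /andP[fe fF]; rewrite ltn_neqAle emin // andbT.
    by apply: contraNneq fe => E; rewrite (bip_adj_inj FX eF fF E).
  by case/orP=> /lt //=; rewrite (wC y x).
have [x [y [xy wxy cxy]]] : exists x y, [/\ (x, y) = e \/ (y, x) = e, w x y = w e.1 e.2
    & size (col x) <= size (col y)].
  have [le|/ltnW le] := leqP (size (col e.1)) (size (col e.2)).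
    by exists e.1, e.2; split=> //; left; case: (e).
  by exists e.2, e.1; split=> //; right; case: (e).
have adjF u v : adj (F :\ e) u v -> adj F u v.
  by case/orP; rewrite inE => /andP[_]; rewrite /adj => ->; rewrite ?orbT.
have yx : y \notin col x.
  apply/negP => /acol /heavier; rewrite wxy ltnn //.
have allready z : ready col z (w x y).+1 (size (col z)).
  rewrite /ready leqnn take_size wxy; apply/allP => u /acol /heavier //.
exists (fun z => if z == x then rcons (col z) y else col z); split.
- by move=> z; case: eqP => [->|//]; rewrite rcons_uniq yx ucol.
- move=> z u; case: eqP => [->|_ /acol/adjF//]; rewrite mem_rcons inE.
  case/orP=> [/eqP->|/acol/adjF//]; rewrite /adj.
  by case: xy => ->; rewrite eF ?orbT.
- rewrite (cardsD1 e F) eF -scol (bigD1 x) //= [in RHS](bigD1 x) //= eqxx size_rcons.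
  rewrite addSn add1n.
  by congr (_ + _).+1; apply: eq_bigr => z /negbTE->.
move=> z h u; case: eqP => [->|_].
  rewrite size_rcons ltnS leq_eqVlt nth_rcons => /orP[/eqP hE|hx].
    rewrite hE ltnn eqxx => <-.
    by rewrite !ready_rcons //; apply: ready_le (allready _).
  by rewrite hx => /(tcol _ _ _ hx)/andP[? ?]; rewrite !ready_rcons.
by move=> hz /(tcol _ _ _ hz)/andP[? ?]; rewrite !ready_rcons.
Qed.


(** Pigeonhole: cut the list before each member of [z]. It begins in [z], so at most [c] blocks
    share all its entries, at least [c * g.+1] of them, and some block has more than [g]. *)
Lemma first_gap (z s : seq T) g c x :
  x \in z -> count (mem z) (x :: s) <= c -> c * g.+1 <= size (x :: s) ->
  exists s1 v s2 s3,
    [/\ x :: s = s1 ++ v :: s2 ++ s3, v \in z, ~~ has (mem z) s2 & size s2 = g].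
Proof.
elim: c x s => [|c IH] x s xz; first by rewrite /= xz.
rewrite /= xz add1n ltnS => cs sz.
have gs : g <= size s by rewrite -ltnS (leq_trans _ sz) // mulSn leq_addr.
have [hz|nz] := boolP (has (mem z) (take g s)); last first.
  exists [::], x, (take g s), (drop g s).
  by rewrite /= cat_take_drop size_takel.
set i := find (mem z) (take g s).
have ig : i < g by rewrite -(size_takel gs) -has_find.
have iz : nth x s i \in z by have := nth_find x hz; rewrite nth_take.
have E := drop_nth x (leq_trans ig gs).
have [|| s1 [v [s2 [s3 [Es vz nz g2]]]]] := IH (nth x s i) (drop i.+1 s) iz.
- rewrite -E (leq_trans _ cs) // -{2}(cat_take_drop i s) count_cat leq_addl //.
- by rewrite -E size_drop; move: sz; rewrite mulSn /=; lia.
exists (x :: take i s ++ s1), v, s2, s3; split=> //=.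
by rewrite -catA -Es -E cat_take_drop.
Qed.

(** * Prolonging a path through the windows *)

Section Climb.

Variables (X : {set T}) (F : {set T * T}) (col : T -> seq T).
Hypothesis FX : forall x y, (x, y) \in F -> x \in X /\ y \notin X.
Hypothesis colF : height_table F col.

(** The same [b] separates the edges of the path from the heavier [H] lowest cells at its tip, so
    any of these cells that leads to a new vertex prolongs the path. *)
Definition standing b H z : bool :=
  if z is x :: _ then
    [&& uniq z, sorted (adj F) z, descending b z & ready col x b H]
  else false.

(* The [d] cells just below height [H]. *)
Definition window x H d := drop (H - d) (take H (col x)).

Lemma window_uniq x H d : uniq (window x H d).
Proof. by case: colF => u *; rewrite drop_uniq ?take_uniq. Qed.

Lemma size_window x b H d : d <= H -> ready col x b H -> size (window x H d) = d.
Proof. by move=> dH /andP[sH _]; rewrite size_drop size_takel ?subKn. Qed.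

Lemma window_ready x b H d u : ready col x b H -> u \in window x H d ->
  [/\ adj F x u, b <= w x u, ready col x (w x u).+1 (H - d)
    & ready col u (w x u).+1 (H - d)].
Proof.
move=> /andP[sH aH] uw; have ut := mem_drop uw.
case: colF => _ acol _ tcol.
split; [exact/acol/(mem_take ut) | exact: (allP aH) | |].
(* The cell lies at height [H - d + i], and the table makes both its ends ready up to that height,
   hence up to [H - d]. *)
all: case/(nthP x): uw => i; rewrite size_drop size_takel // => iH.
all: have hH : H - d + i < H by rewrite -ltn_subRL.
all: rewrite nth_drop nth_take // => E.
all: have /andP[r1 r2] := tcol _ _ _ (leq_trans hH sH) E.
- exact: ready_le (leqnn _) (leq_addr _ _) r1.
- exact: ready_le (leqnn _) (leq_addr _ _) r2.
Qed.

Lemma standing_step b H d x z u : d <= H -> standing b H (x :: z) ->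
  u \in window x H d -> u \notin x :: z ->
  standing (w x u).+1 (H - d) (u :: x :: z).
Proof.
move=> dH /and4P[uz sz dz rx] uw uNz.
have [axu bxu _ ru] := window_ready rx uw.
apply/and4P; split=> //; first by rewrite cons_uniq uNz.
  by rewrite /= (sz : path _ x z) andbT /adj orbC.
by rewrite /= (wC u x) ltnSn; apply: (@descending_le b _ (x :: z)).
Qed.

Lemma standing_suffix b H s1 u s2 : standing b H (s1 ++ u :: s2) ->
  [/\ uniq (u :: s2), sorted (adj F) (u :: s2) & descending b (u :: s2)].
Proof.
move=> st; have [us ss ds] : [/\ uniq (s1 ++ u :: s2), sorted (adj F) (s1 ++ u :: s2)
    & descending b (s1 ++ u :: s2)].
  by move: st; rewrite /standing; case: (s1 ++ u :: s2) => // a l /and4P[].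
split; last exact: descending_suffix ds.
  by move: us; rewrite cat_uniq => /and3P[].
by move: ss; case: s1 {st us ds} => // a s1; rewrite /= cat_path => /and3P[].
Qed.

Definition reaches p j H u : Prop :=
  exists t z b, [/\ t ++ p = u :: z, size t <= j & standing b H (u :: z)].

(** If [u] already lies on the added part [t], the path is cut back to [u]; the edge from [r] to
    [u], though not traversed, still certifies that column [u] is ready. Hence [reaches] bounds the
    length of [t] instead of fixing it. *)
Lemma reaches_step p j H d r u : d <= H -> reaches p j H r ->
  u \in window r H d -> u \notin p -> reaches p j.+1 (H - d) u.
Proof.
move=> dH [t [z [b [E tj st]]]] uw up.
have rr : ready col r b H by case/and4P: st.
have [uz|uNz] := boolP (u \in r :: z); last first.
  exists (u :: t), (r :: z), (w r u).+1.
  split; [by rewrite /= E | by [] | exact: standing_step st uw uNz].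
have ut : u \in t by move: uz; rewrite -E mem_cat (negbTE up) orbF.
case/splitPr: ut E tj => t1 t2 E tj.
rewrite -E -catA cat_cons in st.
have [us ss ds] := standing_suffix st.
have [_ bru _ ru] := window_ready rr uw.
exists (u :: t2), (t2 ++ p), (w r u).+1; split=> //.
  by rewrite (leq_trans _ (leqW tj)) // size_cat leq_addl.
apply/and4P; split=> //.
by apply: descending_le ds; rewrite leqW.
Qed.

Lemma short_step b p H d : size p < d -> d <= H -> standing b H p ->
  exists u c, standing c (H - d) (u :: p).
Proof.
case: p => // y p pd dH st; have ry : ready col y b H by case/and4P: st.
have [inp|/allPn[u uw uNp]] := boolP (all (mem (y :: p)) (window y H d)).
  have := uniq_leq_size (window_uniq y H d) (allP inp).
  by rewrite (size_window dH ry) leqNgt pd.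
by exists u, (w y u).+1; apply: standing_step st uw uNp.
Qed.

(* After dropping at most one vertex, [Q] starts in [R], at the tip of some
   [t ++ p] with [size t <= j].  Vertices of [Q] avoid [p] except its tip, so [Q]
   meets [t ++ p] at most [q] times and a gap of length [g] follows some meeting
   point [v]; the new path follows [t ++ p] up to [v], then that gap. *)
Lemma detour p H d j g q (R : {set T}) (E : {set T * T}) B Q :
  d <= H -> j < q -> 0 < g ->
  (forall r, r \in R -> reaches p j H r) ->
  (forall r u, (r, u) \in E ->
     [/\ r \in R, u \notin R, u \in window r H d & u \notin p]) ->
  q * g.+1 < size Q -> uniq Q -> sorted (adj E) Q -> descending B Q ->
  exists b p', standing b (H - d) p' /\ size p + g <= size p'.
Proof.
move=> dH jq g0 reachR ER sQ uQ aQ dQ.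
(* Lists run from the tip, so the start of [Q] is its last entry. Every arc of [E] has an end in
   [R], and the strict bound on [size Q] pays for the vertex that may be dropped. *)
have [s [x1 [x0 [{}sQ {}uQ {}aQ {}dQ x0R]]]] : exists s x1 x0, let Q' := s ++ [:: x1; x0] in
    [/\ q * g.+1 <= size Q', uniq Q', sorted (adj E) Q', descending B Q' & x0 \in R].
  have q2 : 2 <= q * g.+1 by rewrite (@leq_mul 1 2) //; lia.
  case/lastP: Q sQ uQ aQ dQ => // Q a.
  case/lastP: Q => [|Q b]; first by rewrite ltnS /= leqNgt (leq_trans _ q2).
  rewrite !size_rcons ltnS => sQ uQ aQ dQ.
  have [aR|aNR] := boolP (a \in R).
    exists Q, b, a; rewrite -cat_rcons cats1; split=> //.
    by rewrite !size_rcons leqW.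
  have bR : b \in R.
    have : adj E b a by apply: (@sorted_consecutive _ Q _ _ [::]); rewrite -cat_rcons cats1.
    by case/orP=> /ER[] // aR; rewrite aR in aNR.
  case/lastP: Q sQ uQ aQ dQ => [|Q c]; first by rewrite leqNgt q2.
  rewrite -(cats1 _ a) -(cats1 _ b) -(cats1 _ c) -(catA Q) /=.
  rewrite size_cat /= addn1 => sQ uQ aQ dQ; exists Q, c, b; split=> //=.
  - by move: sQ; rewrite size_cat /= addn2.
  - by move: uQ; rewrite cat_uniq => /and3P[].
  - by have [] := cat_sorted2 aQ.
  - exact: descending_prefix dQ.
set Q' := s ++ _ in sQ uQ aQ dQ.
have adjE x y : adj E x y -> adj F x y.
  case/orP=> /ER[rR _ uw _]; have [t [z [b [_ _ /and4P[_ _ _ rr]]]]] := reachR _ rR.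
    by have [] := window_ready rr uw.
  by have [] := window_ready rr uw; rewrite /adj orbC.
have x01E : (x0, x1) \in E.
  by have /orP[/ER[_ /negP]|] := sorted_consecutive aQ.
have [t [z [b [Ez tj st]]]] := reachR _ x0R.
have rx0 : ready col x0 b H by case/and4P: st.
(* The last edge of the list is its lightest; being a window cell of [x0], it already weighs at
   least [b]. *)
have bx : b <= w x1 x0.
  by have [_ _ x1w _] := ER _ _ x01E; have [_ + _ _] := window_ready rx0 x1w; rewrite wC.
have lowQ := descending_low dQ bx.
(* Targets of arcs avoid [p], so such an [a] lies in [R] and is the tip of a simple path [t' ++ p];
   as [a] is in [p], [t'] is empty. *)
have Qp a : a \in Q' -> a \in p -> exists p', p = a :: p'.
  move=> aQ' ap; have [s1 [s2 QE]] : exists s1 s2, Q' = s1 ++ a :: s2.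
    by move: (Q') aQ' => Q0 /splitPr[s1 s2]; exists s1, s2.
  have [t' [z' [b' [E' _ /and4P[uz _ _ _]]]]] : reaches p j H a.
    apply: reachR; case: s2 QE => [/(congr1 (last a))|a' s2 QE].
      by rewrite /Q' !last_cat /= => <-.
    by move: aQ; rewrite QE => /sorted_consecutive /orP[/ER[] // | /ER[_ _ _]]; rewrite ap.
  case: t' E' => [/= ->|c t' [_ E']]; first by exists z'.
  by move: uz; rewrite /= -E' mem_cat ap orbT.
have cQ : count (mem (x0 :: z)) (rev Q') <= q.
  rewrite count_rev -size_filter.
  apply: (@leq_trans (size (head x0 p :: t))); last exact: leq_ltn_trans tj jq.
  apply: uniq_leq_size; first exact: filter_uniq.
  move=> a; rewrite mem_filter -Ez !inE mem_cat => /andP[/orP[->|ap] aQ']; first by rewrite orbT.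
  by have [p' ->] := Qp _ aQ' ap; rewrite eqxx.
have revQ : rev Q' = x0 :: x1 :: rev s by rewrite rev_cat.
have sr : q * g.+1 <= size (rev Q') by rewrite size_rev.
rewrite revQ in cQ sr.
have [s1 [v [s2 [s3 [Es vz nz sg]]]]] := first_gap (mem_head _ _) cQ sr.
have QE : Q' = rev s3 ++ rev s2 ++ v :: rev s1.
  by rewrite -(revK Q') revQ Es !rev_cat rev_cons rev_cat -!cats1 -!catA.
case ES : (rev s2) => [|y S] in QE; first by move: g0; rewrite -sg -size_rev ES.
have [z1 [z2 Ez2]] : exists z1 z2, x0 :: z = z1 ++ v :: z2.
  by move: (x0 :: z) vz => Z /splitPr[z1 z2]; exists z1, z2.
have [uz az dz] : [/\ uniq (v :: z2), sorted (adj F) (v :: z2) & descending b (v :: z2)].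
  by apply: (@standing_suffix b H z1); rewrite -Ez2.
(* The vertex [n] next to the new tip [y] is the same in [Q'] and in the new path (it is [v] when
   the gap has one vertex), so the arc joining them makes [y] ready. *)
have [n [Q1 [N [EQ EN]]]] : exists n Q1 N, S ++ v :: rev s1 = n :: Q1 /\ S ++ v :: z2 = n :: N.
  by case: (S) => [|n S']; do 3!eexists.
have [ayn yQ] : adj E y n /\ descending (w y n).+1 (y :: S ++ v :: rev s1).
  move: aQ dQ; rewrite QE cat_cons EQ => /sorted_consecutive -> /descending_suffix dQ.
  by split=> //; apply: descending_head dQ.
have lowv : b <= w (last v (y :: S)) v.
  apply: (@sorted_consecutive (fun x y => b <= w x y) (rev s3 ++ belast y S) _ _ (rev s1)).
  by rewrite -catA -cat_rcons -lastI -QE.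
have vQ : v \in Q' by rewrite QE !mem_cat !inE eqxx !orbT.
exists (w y n).+1, (y :: S ++ v :: z2); split.
  apply/and4P; split.
  - rewrite -cat_cons cat_uniq uz andbT; apply/andP; split.
      by move: uQ; rewrite QE !cat_uniq => /and3P[_ _ /and3P[]].
    apply: contra nz => /hasP[a avz]; rewrite -ES /= mem_rev => as2.
    by apply/hasP; exists a => //=; rewrite Ez2 mem_cat avz orbT.
  - have := sub_sorted adjE aQ; rewrite QE => /cat_sorted2[_].
    by rewrite -cat_cons !sorted_cat_cons => /andP[-> _].
  - exact: (@descending_splice _ _ (y :: S) _ _ _ _ yQ lowv dz).
  - case/orP: ayn => /ER[rR _ uw _]; have [t' [z' [b' [_ _ /and4P[_ _ _ rr]]]]] := reachR _ rR.
      by have [] := window_ready rr uw.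
    by have [] := window_ready rr uw; rewrite wC.
(* Cutting back to [v] gives up at most [size t] vertices, since [v] is on [t] or is the tip of [p];
   the net gain is thus at least [g]. *)
have z1t : size z1 <= size t.
  have <- : index v (t ++ p) = size z1.
    have : uniq (x0 :: z) by case/and4P: st.
    rewrite Ez Ez2 index_cat /= eqxx addn0 cat_uniq => /and3P[_ nv _].
    by case: ifP => // vz1; case/hasP: nv; exists v; rewrite ?mem_head.
  rewrite index_cat; case: ifP => [vt|vt]; first by rewrite ltnW // index_mem.
  have vp : v \in p by move: vz; rewrite -Ez mem_cat vt.
  by have [p' ->] := Qp _ vQ vp; rewrite /= eqxx addn0.
have := congr1 size Ez; rewrite Ez2 /= !size_cat /=.
rewrite -sg -(size_rev s2) ES /= => Esz.
by rewrite addnS ltnS addnC leq_add2l -(leq_add2l (size t)) Esz leq_add2r.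
Qed.

Lemma card_window_arcs p H d (R : {set T}) :
  (forall r, r \in R -> size (window r H d) = d) ->
  #|R| * (d - size p) <=
    #|[set e : T * T | (e.1 \in R) && ((e.2 \in window e.1 H d) && (e.2 \notin p))]|.
Proof.
move=> wR; rewrite -sum1dep_card.
rewrite -(pair_big_dep (mem R) (fun r u => (u \in window r H d) && (u \notin p)) (fun _ _ => 1)).
rewrite -sum_nat_const; apply: leq_sum => r rR; rewrite sum1_card.
have /card_uniqP cw : uniq [seq u <- window r H d | u \notin p].
  by rewrite filter_uniq ?window_uniq.
have -> : #|[pred u | (u \in window r H d) && (u \notin p)]| =
    #|[seq u <- window r H d | u \notin p]|.
  by apply: eq_card => u; rewrite !inE mem_filter andbC.
rewrite cw size_filter -{1}(wR _ rR) -(count_predC (mem p) (window r H d)) leq_subLR.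
apply: leq_add => //; rewrite -size_filter; apply: uniq_leq_size.
  by rewrite filter_uniq ?window_uniq.
by move=> u; rewrite mem_filter => /andP[].
Qed.

Lemma standing_le b H H' p : H' <= H -> standing b H p -> standing b H' p.
Proof.
case: p => // y p HH /and4P[uz sz dz r]; apply/and4P; split=> //; exact: ready_le r.
Qed.

Lemma round b p H D g q d :
  forces D (q * g.+1) -> 0 < g -> #|T| < 2 ^ q -> size p + 3 * D < d ->
  q * d <= H -> standing b H p ->
  exists b' p', standing b' (H - q * d) p' /\ size p + g <= size p'.
Proof.
move=> fD g0 Tq pd qH st.
set goal := exists b', _.
(* Each reached set lies on one side [s] of the bipartition, so consecutive sets are disjoint and
   the arcs between them are bipartite. *)
suff claim j : j <= q -> goal \/ exists (R : {set T}) s, [/\ 2 ^ j <= #|R|,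
    forall r, r \in R -> reaches p j (H - j * d) r & forall r, r \in R -> (r \in X) = s].
  have [//|[R [_ [qR _ _]]]] := claim _ (leqnn q).
  by have := leq_trans (leq_ltn_trans (max_card (mem R)) Tq) qR; rewrite ltnn.
elim: j => [|j IH] jq.
  right; case: p st {pd goal} => // y p st; exists [set y], (y \in X).
  rewrite cards1 mul0n subn0; split=> // r /set1P-> //.
  by exists [::], p, b.
have [|[R [s [jR reachR sideR]]]] := IH (ltnW jq); first by left.
have dH : d <= H - j * d.
  rewrite leq_subRL; first by rewrite -mulSnr (leq_trans _ qH) // leq_mul2r jq orbT.
  by rewrite (leq_trans _ qH) // leq_mul2r ltnW ?orbT.
pose E := [set e : T * T | (e.1 \in R) && ((e.2 \in window e.1 (H - j * d) d) && (e.2 \notin p))].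
have sideE r u : (r, u) \in E -> (u \in X) = ~~ s.
  rewrite inE => /and3P[rR uw _]; have [t [z [b1 [_ _ /and4P[_ _ _ rr]]]]] := reachR _ rR.
  have [aru _ _ _] := window_ready rr uw; rewrite -(sideR _ rR).
  by case/orP: aru => /FX[-> /negbTE->].
have ER r u : (r, u) \in E ->
    [/\ r \in R, u \notin R, u \in window r (H - j * d) d & u \notin p].
  move=> ruE; have uX := sideE _ _ ruE; move: ruE; rewrite inE => /and3P[-> -> ->]; split=> //.
  by apply/negP => /sideR; rewrite uX; case: (s).
pose R' := [set e.2 | e in E].
have HE : H - j.+1 * d = H - j * d - d by rewrite mulSnr subnDA.
have [RR|RR] := leqP (2 * #|R|) #|R'|.
  right; exists R', (~~ s); split.
  - by rewrite expnS (leq_trans _ RR) // leq_mul2l jR.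
  - move=> _ /imsetP[[r u] /ER[rR _ uw up] ->]; rewrite HE.
    exact: reaches_step (reachR _ rR) uw up.
  - by move=> _ /imsetP[[r u] /sideE uX ->].
(* Few new vertices: the arcs [E] are dense on [R :|: R']. *)
left; have [||Q [lQ uQ aQ [B dQ]]] := fD R (R :|: R') E.
- move=> r u ruE; have [rR uR _ _] := ER _ _ ruE; split=> //; rewrite inE ?rR //.
  by apply/orP; right; apply/imsetP; exists (r, u).
- have R0 : 0 < #|R| by rewrite (leq_trans _ jR) // expn_gt0.
  have cE : #|R| * (d - size p) <= #|E|.
    apply: card_window_arcs => r /reachR[t [z [b1 [_ _ /and4P[_ _ _ rr]]]]].
    exact: size_window rr.
  apply: leq_trans cE.
  (* [R :|: R'] has at most [3 * #|R|] vertices, while each vertex of [R] sends at least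
     [d - size p > 3 * D] arcs. *)
  apply: leq_ltn_trans (_ : D * (3 * #|R|) < _).
    rewrite leq_mul2l (leq_trans (leq_card_setU _ _)) ?orbT //.
    by rewrite mulSn leq_add2l ltnW.
  by rewrite mulnA mulnC ltn_mul2l R0 mulnC ltn_subRL.
have [b' [p' [st' sp']]] := detour dH jq g0 reachR ER lQ uQ aQ dQ.
exists b', p'; split=> //; apply: standing_le st'.
by rewrite -HE leq_sub2l // leq_mul2r jq orbT.
Qed.

End Climb.

(** * The bootstrap *)

Lemma forces_of_rounds eta g t L : L <= t * g ->
  (forall (X : {set T}) (F : {set T * T}) (col : T -> seq T),
     (forall x y, (x, y) \in F -> x \in X /\ y \notin X) ->
     height_table F col -> forall b p H, size p <= L -> eta <= H ->
     standing F col b H p ->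
     exists b' p', standing F col b' (H - eta) p' /\ size p + g <= size p') ->
  forces (t * eta) L.
Proof.
move=> Ltg rounds X U F FXU DF.
have FX x y : (x, y) \in F -> x \in X /\ y \notin X by case/FXU.
have [col colF] := height_table_exists FX.
(* Averaging: the column sizes sum to [#|F|], and columns outside [U] are empty. *)
have [y ty] : exists y, t * eta <= size (col y).
  apply/existsP; apply: contraLR DF => /existsPn small; rewrite -leqNgt.
  case: colF => _ acol <- _; rewrite (bigID (mem U)) /= [X in _ + X]big1 ?addn0.
    rewrite mulnC -sum_nat_const; apply: leq_sum => x _; apply: ltnW; rewrite ltnNge; exact: small.
  move=> x xU; case E : (col x) => [//|u s]; case/negP: xU.
  by have := acol x u; rewrite E mem_head => /(_ isT) /orP[] /FXU[].
have st0 : standing F col 0 (t * eta) [:: y].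
  by rewrite /standing /= /ready ty; apply/allP.
(* Each round costs [eta] levels and gains [g] vertices; the climb stops once the path has more than
   [L] vertices, where [rounds] ceases to apply. *)
have climb n b H p : n * eta <= H -> standing F col b H p -> L < size p + n * g ->
    exists b' H' p', L < size p' /\ standing F col b' H' p'.
  elim: n b H p => [|n IH] b H p nH st; first by rewrite addn0; exists b, H, p.
  have [Lp _|pL Ln] := ltnP L (size p); first by exists b, H, p.
  have etaH : eta <= H by apply: leq_trans nH; rewrite mulSn leq_addr.
  have [b' [p' [st' sp']]] := rounds X F col FX colF b p H pL etaH st.
  apply: (IH b' (H - eta) p') => //; first by rewrite leq_subRL // -mulSn.
  by apply: leq_trans Ln _; rewrite mulSn addnA leq_add2r.
have [||b [H [p [sp st]]]] := climb t _ _ _ _ st0; rewrite ?add1n ?ltnS //.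
case: p sp st => // x p sp /and4P[up ap dp _].
by exists (x :: p); split=> //; exists b.
Qed.

(** A window of [L.+1] cells always leaves a path of at most [L] vertices, so one vertex is gained
    per [L.+1] levels. *)
Lemma forces_square L : forces (L * L.+1) L.
Proof.
apply: (@forces_of_rounds _ 1); first by rewrite muln1.
move=> X F col FX colF b p H pL LH st.
have [u [c st']] := short_step colF (pL : size p < L.+1) LH st.
by exists c, (u :: p); split=> //; rewrite addn1.
Qed.

Lemma forces_step D L q g t : 0 < g -> #|T| < 2 ^ q -> L <= t * g ->
  forces D (q * g.+1) -> forces (t * (q * (L + 3 * D).+1)) L.
Proof.
move=> g0 Tq Ltg fD; apply: (forces_of_rounds Ltg) => X F col FX colF b p H pL.
by apply: (round FX colF fD) => //; rewrite ltnS leq_add2r.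
Qed.

(* [scale Y k] is Y^((k+1)(k+2)/2). *)
Fixpoint scale (Y k : nat) : nat := if k is k'.+1 then scale Y k' * Y ^ k.+1 else Y.

(** Apply [forces_step] with D = L = a_(k+1), a_k = q c, g = c - 1 and t = 2 q Y^(k+2). The 2
    absorbs the loss from c to c - 1, and 4 L + 1 <= 5 L; together they cost 10 q^2 = Y, which
    brings t q (4 L + 1) under a_(k+2). *)
Lemma forces_scale q k : 0 < q -> #|T| < 2 ^ q ->
  forces (scale (10 * q ^ 2) k.+1) (scale (10 * q ^ 2) k).
Proof.
set Y := 10 * q ^ 2 => q0 Tq; have Y0 : 0 < Y by rewrite muln_gt0 expn_gt0 q0.
have dvdY n : exists c, scale Y n = q * c /\ 1 < c.
  elim: n => [|n [c [/= -> c1]]].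
    by exists (10 * q); rewrite /= /Y; split; [lia | lia].
  exists (c * Y ^ n.+2); rewrite mulnA; split=> //.
  by rewrite (leq_trans c1) // leq_pmulr // expn_gt0 Y0.
elim: k => [|k IH].
  refine (forces_mono _ (leqnn _) (@forces_square Y)).
  by rewrite /= leq_mul2l -mulnn ltn_Pmulr ?orbT // /Y; lia.
have [c [Ec c1]] := dvdY k.
have Z0 : 0 < Y ^ k.+2 by rewrite expn_gt0 Y0.
have L0 : 0 < scale Y k.+1 by rewrite /= muln_gt0 Z0 Ec muln_gt0 q0 ltnW.
have fs : forces (2 * q * Y ^ k.+2 * (q * (scale Y k.+1 + 3 * scale Y k.+1).+1)) (scale Y k.+1).
  apply: (@forces_step _ _ _ c.-1) => //; first by lia.
    rewrite /= Ec -(mulnA 2) -mulnA mulnAC; set Z := _ ^ _ in Z0 *; nia.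
  by rewrite prednK -?Ec // ltnW.
refine (forces_mono _ (leqnn _) fs); rewrite [scale Y k.+2]/= -/(scale Y k.+1) [Y ^ k.+3]expnS.
move: (scale Y k.+1) L0 (Y ^ k.+2) => L L0 Z.
have -> : L * (Y * Z) = (2 * q * Z) * (q * (5 * L)) by rewrite /Y; lia.
by rewrite !leq_mul2l; apply/orP; right; apply/orP; right; lia.
Qed.

End WeightedGraph.

(** * From edge-orderings to weights *)

Section CompleteGraph.

Variables (n : nat) (le : rel {set 'I_n}).
Hypothesis le_ord : edge_ordering le.

Definition edge_rank (e : {set 'I_n}) := #|[set f | is_edge f && le f e]|.

Lemma edge_rank_le e f : is_edge e -> is_edge f -> edge_rank e <= edge_rank f -> le e f.
Proof.
case: le_ord => refl _ trans tot eE fE; apply: contraTT => ef.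
have fe : le f e by have := tot _ _ eE fE; rewrite (negbTE ef).
rewrite -ltnNge; apply: proper_card; apply/properP; split.
  apply/subsetP => g; rewrite !inE => /andP[gE gf]; rewrite gE /=.
  exact: trans gf fe.
by exists e; rewrite !inE eE ?refl.
Qed.

Lemma edge_rank_inj e f : is_edge e -> is_edge f -> edge_rank e = edge_rank f -> e = f.
Proof.
case: le_ord => _ anti _ _ eE fE ef.
by apply: anti => //; apply: edge_rank_le; rewrite // ef.
Qed.

Let w (x y : 'I_n) := edge_rank [set x; y].

Lemma is_edge_pair (x y : 'I_n) : x != y -> is_edge [set x; y].
Proof. by rewrite /is_edge cards2 => ->. Qed.

Lemma descending_monotone b p :
  uniq p -> descending w b p -> monotone_path le p.
Proof.
move=> up dp; split=> //; right; elim: p b up dp => // x [|y [|z p]] IH b //.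
move=> /andP[xNyz uyz] /andP[_ dyz]; have ds := IH _ uyz dyz.
apply/andP; split=> //; apply: edge_rank_le.
- by apply: is_edge_pair; move: uyz; rewrite /= !inE negb_or => /andP[/andP[]].
- by apply: is_edge_pair; move: xNyz; rewrite !inE !negb_or => /andP[].
- by case/andP: dyz => /ltnW.
Qed.

(** The complete bipartite graph between two halves has at least (n^2 - 1)/4 edges, which exceeds
    n^2/8 >= D n once n > 1. *)
Lemma forces_monotone_path D l : forces w D l -> 1 < n -> 8 * D <= n ->
  exists p, monotone_path le p /\ l <= (size p).-1.
Proof.
move=> fDl n1 Dn.
pose X := [set x in take n./2 (enum 'I_n)].
have cX : #|X| = n./2.
  rewrite cardsE (card_uniqP _) ?take_uniq ?enum_uniq // size_takel //.
  by rewrite size_enum_ord; lia.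
have [||p [lp up _ [b dp]]] := fDl X setT (setX X (~: X)).
- by move=> x y; rewrite !inE => /andP[-> ->].
- rewrite cardsX cardsT card_ord; have := cardsC X; rewrite cX card_ord => cC.
  have -> : #|~: X| = n - n./2 by lia.
  have nE := odd_double_half n; move: (n./2) nE => m nE.
  have -> : n - m = odd n + m by lia.
  have r1 : odd n <= 1 by case: (odd n).
  move: (nat_of_bool (odd n)) r1 nE => r r1 nE.
  have : 8 * (D * n) <= n * n by rewrite mulnA leq_mul2r Dn orbT.
  rewrite -{2 3}nE -addnn; nia.
exists p; split; first exact: descending_monotone up dp.
by case: p lp {up dp}.
Qed.

End CompleteGraph.

(** * Numerical estimates *)

Lemma scale_gt Y k : 1 < Y -> k < scale Y k.
Proof.
move=> Y1; elim: k => [|k IH] /=; first exact: ltnW.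
rewrite (leq_ltn_trans IH) // ltn_Pmulr ?(leq_ltn_trans _ IH) //.
by rewrite -(exp1n k.+2) ltn_exp2r.
Qed.

(** Squaring clears the half in the exponent, and (k+1)(k+2) >= (k+1)^2. This is what later bounds k
    in terms of n. *)
Lemma scale_sqr Y k : 0 < Y -> Y ^ (k.+1 ^ 2) <= scale Y k ^ 2.
Proof.
move=> Y0; elim: k => [|k IH] /=; first by rewrite exp1n expn1 -mulnn leq_pmulr.
rewrite expnMn -expnM; apply: leq_trans (leq_mul IH (leqnn _)).
by rewrite -expnD leq_pexp2l // -!mulnn; lia.
Qed.

Lemma poly_le_exp q : 51 < q -> 8 * (10 * q ^ 2) ^ 3 <= 2 ^ q.-1.
Proof.
move=> /subnK <-; rewrite expnMn -expnM mulnA addnS /=.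
elim: (q - 52) => [|m].
  (* 10 <= 2^4 and 52 <= 2^6 bound the left side by 2^(3+12+36) = 2^51, the threshold of the
     theorem. *)
  rewrite !add0n; apply: (@leq_trans (2 ^ 3 * (2 ^ 4) ^ 3 * (2 ^ 6) ^ (2 * 3))).
    by apply: leq_mul; [apply: leq_mul; rewrite ?leq_exp2r | rewrite leq_exp2r].
  by rewrite -!expnM -!expnD leq_exp2l.
rewrite !addSn [2 ^ _.+1]expnS -addnS => IH; apply: leq_trans (leq_mul (leqnn 2) IH).
rewrite mulnCA leq_mul2l; apply/orP; right.
(* One step multiplies the left side by at most (5/4)^3 < 2. *)
have q4 : 4 * (m + 53) ^ 2 <= 5 * (m + 52) ^ 2 by rewrite -!mulnn; nia.
rewrite -addnS !(expnM _ 2 3); move: ((m + 53) ^ 2) ((m + 52) ^ 2) q4 => A B AB.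
have : (4 * A) ^ 3 <= (5 * B) ^ 3 by rewrite leq_exp2r.
by rewrite !expnMn; move: (A ^ 3) (B ^ 3) => A3 B3; lia.
Qed.

Section Estimate.
Local Open Scope R_scope.

Lemma shifted_square_le_cube x : 16 <= x -> 10 * (x + 1) ^ 2 <= x ^ 3.
Proof. intros hx; nra. Qed.

Lemma ln_le_mono x y : 0 < x -> x <= y -> ln x <= ln y.
Proof.
intros hx [h | ->]; [left; apply ln_increasing; assumption | right; reflexivity].
Qed.

Lemma INR_addn m n : INR (m + n)%N = INR m + INR n.
Proof. exact: plus_INR. Qed.

Lemma INR_muln m n : INR (m * n)%N = INR m * INR n.
Proof. exact: mult_INR. Qed.

Lemma INR_expn m n : INR (m ^ n)%N = pow (INR m) n.
Proof. by elim: n => [|n IH] //; rewrite expnS INR_muln IH. Qed.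

Lemma INR_leq m n : (m <= n)%N -> INR m <= INR n.
Proof. by move/leP/le_INR. Qed.

(** With L = log n, lam = log L and Z = sqrt(L lam), one has log Y <= 3 lam and (k+2)^2 log Y <= 2
    L. Multiplying, (k+2) log Y <= sqrt(6) Z <= 5/2 Z. Since 2k+5 <= 3(k+2) and Z >= 1, the exponent
    is at most 3 + 15/2 Z <= 11 Z. *)
Lemma path_length_estimate (n a Y q k : nat) :
  (17 <= q)%N -> (0 < n)%N -> Y = (10 * q ^ 2)%N ->
  (2 ^ q.-1 <= n)%N ->
  (n <= a * (8 * Y ^ (2 * k + 5)))%N ->
  (Y ^ ((k + 2) ^ 2) <= n ^ 2)%N ->
  INR n / Rpower 2 (11 * sqrt (log2 (INR n) * log2 (log2 (INR n)))) <= INR a.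
Proof.
intros hq hn hY h2q hna hYn.
assert (l2 : 0 < ln 2) by (rewrite <- ln_1; apply ln_increasing; lra).
assert (n0 : 0 < INR n) by (apply lt_0_INR; exact: (elimT leP hn)).
assert (q17 : 17 <= INR q) by (apply INR_leq in hq; simpl in hq; lra).
assert (y_eq : INR Y = 10 * INR q ^ 2).
{ rewrite hY INR_muln INR_expn; simpl; ring. }
assert (Y0 : 1 < INR Y) by nra.
assert (lY0 : 0 < ln (INR Y)) by (rewrite <- ln_1; apply ln_increasing; lra).
set (L := log2 (INR n)).
assert (LE : ln (INR n) = L * ln 2) by (unfold L, log2; field; lra).
assert (qL : INR q - 1 <= L).
{ assert (q1 : INR q = INR q.-1 + 1)
    by (rewrite -S_INR; destruct q; [discriminate hq | reflexivity]).
  apply INR_leq in h2q; rewrite INR_expn in h2q.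
  apply ln_le_mono in h2q; [|apply pow_lt; simpl; lra].
  rewrite -> ln_pow in h2q by (simpl; lra).
  simpl (INR 2) in h2q; rewrite LE in h2q.
  replace (1 + 1) with 2 in h2q by ring.
  apply Rmult_le_reg_r in h2q; lra. }
assert (L16 : 16 <= L) by lra.
set (lam := log2 L).
assert (lamE : ln L = lam * ln 2) by (unfold lam, log2; field; lra).
assert (lam1 : 1 <= lam).
{ assert (ln 2 <= ln L) by (apply ln_le_mono; lra).
  apply Rmult_le_reg_r with (ln 2); lra. }
assert (Y3 : ln (INR Y) <= 3 * (lam * ln 2)).
{ rewrite <- lamE. replace 3 with (INR 3) by (simpl; ring).
  rewrite <- ln_pow by lra. apply ln_le_mono; [lra|].
  apply Rle_trans with (2 := shifted_square_le_cube L16). rewrite y_eq. nra. }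
assert (k0 : 0 <= INR k) by apply pos_INR.
assert (k2 : (INR k + 2) ^ 2 * ln (INR Y) <= 2 * (L * ln 2)).
{ apply INR_leq in hYn. rewrite -> !INR_expn in hYn.
  apply ln_le_mono in hYn; [|apply pow_lt; lra].
  rewrite -> !ln_pow, INR_expn, INR_addn, LE in hYn by lra. simpl (INR 2) in hYn.
  replace (1 + 1) with 2 in hYn by ring. exact hYn. }
set (Z := sqrt (L * lam)).
assert (ZZ : Z * Z = L * lam) by (apply sqrt_sqrt; nra).
assert (Z1 : 1 <= Z).
{ unfold Z; rewrite <- sqrt_1; apply sqrt_le_1_alt; nra. }
assert (Ll : 0 < L * ln 2) by (apply Rmult_lt_0_compat; lra).
assert (Zl : 0 < Z * ln 2) by (apply Rmult_lt_0_compat; lra).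
assert (kZ : (INR k + 2) * ln (INR Y) <= 5 / 2 * Z * ln 2).
{ apply Rsqr_incr_0_var; [unfold Rsqr | lra].
  apply Rle_trans with (2 * (L * ln 2) * ln (INR Y)); [nra|].
  apply Rle_trans with (2 * (L * ln 2) * (3 * (lam * ln 2)));
    [apply Rmult_le_compat_l; [lra | exact Y3]|].
  replace (5 / 2 * Z * ln 2 * (5 / 2 * Z * ln 2)) with (25 / 4 * (Z * Z) * (ln 2 * ln 2)) by field.
  rewrite ZZ. assert (0 < L * lam * (ln 2 * ln 2)) by (apply Rmult_lt_0_compat; nra). lra. }
assert (main : 8 * INR Y ^ (2 * k + 5) <= Rpower 2 (11 * Z)).
{ unfold Rpower. rewrite <- (exp_ln (8 * _)).
  2: { apply Rmult_lt_0_compat; [lra | apply pow_lt; lra]. }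
  assert (le_exp : forall x y, x <= y -> exp x <= exp y).
  { intros x y [h | ->]; [left; apply exp_increasing; exact h | right; reflexivity]. }
  apply le_exp. rewrite ln_mult; [| lra | apply pow_lt; lra].
  replace 8 with (2 ^ 3) by ring. rewrite -> !ln_pow by lra.
  rewrite INR_addn INR_muln. simpl INR. nra. }
apply Rmult_le_reg_r with (Rpower 2 (11 * Z)); [apply exp_pos|].
unfold Rdiv. rewrite -> Rmult_assoc, Rinv_l, Rmult_1_r by (apply Rgt_not_eq, exp_pos).
apply INR_leq in hna. rewrite !INR_muln INR_expn in hna. simpl (INR 8) in hna.
apply Rle_trans with (1 := hna). apply Rmult_le_compat_l; [apply pos_INR|].
replace (1 + 1 + 1 + 1 + 1 + 1 + 1 + 1) with 8 by ring. exact main.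
Qed.

End Estimate.

(** * Choice of the parameters *)

Theorem theorem1p1 :
  exists C : R, (0 < C)%R /\
  exists N : nat, forall n : nat, (N <= n)%N ->
    forall le : rel {set 'I_n}, edge_ordering le ->
      exists p : seq 'I_n, monotone_path le p /\
        (INR n / Rpower 2 (C * sqrt (log2 (INR n) * log2 (log2 (INR n))))
           <= INR (size p).-1)%R.
Proof.
exists 11%R; split; first by lra.
exists (2 ^ 51) => n nN le le_ord.
pose q := (trunc_log 2 n).+1; pose Y := 10 * q ^ 2.
have n0 : 0 < n by apply: leq_trans nN; rewrite expn_gt0.
have n1 : 1 < n by apply: leq_trans nN; rewrite -{1}(expn1 2) leq_exp2l.
have nq : n < 2 ^ q by apply: trunc_log_ltn.
have qn : 2 ^ q.-1 <= n by apply: trunc_logP.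
have q51 : 51 < q by rewrite ltnS trunc_log_max.
have Y1 : 1 < Y by rewrite /Y; nia.
(* Take the least k with n < 8 a_(k+2). Minimality gives 8 a_(k+1) <= n, except for k = 0, where
   [poly_le_exp] supplies 8 Y^3 <= n. *)
have [k [kn nk]] : exists k, 8 * scale Y k.+1 <= n /\ n < 8 * scale Y k.+2.
  have ex : exists k, n < 8 * scale Y k.+2.
    by exists n; have := scale_gt n.+2 Y1; lia.
  have [[|k] nk mink] := ex_minnP ex.
    exists 0; split=> //; apply: leq_trans qn; apply: leq_trans (poly_le_exp q51).
    by rewrite /= -expnS.
  by exists k.+1; split=> //; rewrite leqNgt; apply/negP => /mink; rewrite ltnn.
have fk : forces (fun x y => edge_rank le [set x; y]) (scale Y k.+1) (scale Y k).
  apply: forces_scale; rewrite ?card_ord //.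
  - by move=> x y; rewrite setUC.
  - by move=> x y x' y' xy xy'; apply: edge_rank_inj => //; apply: is_edge_pair.
have [p [mp lp]] := forces_monotone_path le_ord fk n1 kn.
exists p; split=> //; apply: Rle_trans (le_INR _ _ (leP lp)).
apply: (@path_length_estimate n (scale Y k) Y q k).
- exact: leq_trans q51.
- exact: n0.
- by [].
- exact: qn.
(* a_(k+2) = a_k Y^(k+2) Y^(k+3), whence the exponent 2k+5. *)
- apply: leq_trans (ltnW nk) _.
  rewrite mulnCA leq_mul2l /= -mulnA -expnD leq_mul2l; apply/orP; right.
  by rewrite leq_pexp2l ?(ltnW Y1) //; lia.
- have := @scale_sqr Y k.+1 (ltnW Y1); rewrite addn2 => sq; apply: leq_trans sq _.
  by rewrite leq_exp2r // (leq_trans _ kn) // leq_pmull.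
Qed.
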